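(* Let $Y\neq\{0\}$ be a Banach space over $\mathbb{K}$. Each of the pairs $(\ell_1,Y)$ and $(c_0,Y)$ fails both property $\mathbf{L}_{o,p}$ and property $\mathbf{L}_{p,o}$.
   Context: Banach spaces are over $\mathbb{K}$, which is $\mathbb{R}$ or $\mathbb{C}$; $\ell_1$ and $c_0$ are the usual sequence spaces over $\mathbb{K}$. $S_X$ denotes the unit sphere of $X$, and $\mathcal{L}(X,Y)$ the space of bounded linear operators from $X$ to $Y$ with the operator norm. A pair $(X,Y)$ of Banach spaces has property $\mathbf{L}_{p,o}$ if for every $\varepsilon>0$ and every $T\in\mathcal{L}(X,Y)$ with $\|T\|=1$ there is $\eta(\varepsilon,T)>0$ such that whenever $x\in S_X$ satisfies $\|T(x)\|>1-\eta(\varepsilon,T)$, there is $S\in\mathcal{L}(X,Y)$ with $\|S\|=1$, $\|S(x)\|=1$ and $\|S-T\|<\varepsilon$. A pair $(X,Y)$ of Banach spaces has property $\mathbf{L}_{o,p}$ if for every $\varepsilon>0$ and every $x\in S_X$ there is $\eta(\varepsilon,x)>0$ such that whenever $T\in\mathcal{L}(X,Y)$ with $\|T\|=1$ satisfies $\|T(x)\|>1-\eta(\varepsilon,x)$, there is $x_0\in S_X$ with $\|T(x_0)\|=1$ and $\|x_0-x\|<\varepsilon$. *)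

(* Defs.v *)
From HB Require Import structures.
From mathcomp Require Import all_boot all_order all_algebra.
From mathcomp Require Import complex.
From mathcomp Require Import all_classical all_reals all_analysis.

Set Implicit Arguments.
Unset Strict Implicit.
Unset Printing Implicit Defensive.

Import Order.TTheory GRing.Theory Num.Theory.
Import numFieldNormedType.Exports.

Local Open Scope classical_set_scope.
Local Open Scope ring_scope.

Variant scalar_kind := RealScalars | ComplexScalars.

Definition scalar_field (R : realType) (k : scalar_kind) : numFieldType :=
  match k with RealScalars => R | ComplexScalars => R[i] end.

Section ScalarMaps.
Variable R : realType.

Definition scalar_re (k : scalar_kind) : scalar_field R k -> R :=
  match k return scalar_field R k -> R with
  | RealScalars => id
  | ComplexScalars => @complex.Re R
  end.

Definition scalar_emb (k : scalar_kind) : R -> scalar_field R k :=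
  match k return R -> scalar_field R k with
  | RealScalars => id
  | ComplexScalars => real_complex R
  end.

End ScalarMaps.

(* The library norm of a [normedModType K] is [K]-valued, also for K = R[i];
   its values are nonnegative reals of [K], read here in [R]. *)
Definition rnorm (R : realType) (k : scalar_kind)
    (V : normedZmodType (scalar_field R k)) (x : V) : R := scalar_re `|x|.

Section ScalarTheory.
Variables (R : realType) (k : scalar_kind).
Local Notation K := (scalar_field R k).

Lemma scalar_embK (r : R) : scalar_re (scalar_emb k r) = r.
Proof. by case: k. Qed.

Lemma scalar_emb0 : scalar_emb k (0 : R) = 0.
Proof. by case: k. Qed.

Lemma scalar_emb_inj : injective (@scalar_emb R k).
Proof. by move=> x y /(congr1 (@scalar_re R k)); rewrite !scalar_embK. Qed.

Lemma scalar_reD (x y : K) : scalar_re (x + y) = scalar_re x + scalar_re y.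
Proof. by move: x y; case: k => // -[a b] [c d]. Qed.

Lemma scalar_embD (x y : R) : scalar_emb k (x + y) = scalar_emb k x + scalar_emb k y.
Proof. by case: k => //=; rewrite rmorphD. Qed.

Lemma scalar_embM (x y : R) : scalar_emb k (x * y) = scalar_emb k x * scalar_emb k y.
Proof. by case: k => //=; rewrite rmorphM. Qed.

Lemma scalar_emb_le (x y : R) : (scalar_emb k x <= scalar_emb k y) = (x <= y).
Proof. by case: k => //=; rewrite lecR. Qed.

Lemma scalar_emb_lt (x y : R) : (scalar_emb k x < scalar_emb k y) = (x < y).
Proof. by case: k => //=; rewrite ltcR. Qed.

Lemma scalar_reK (x : K) : 0 <= x -> scalar_emb k (scalar_re x) = x.
Proof.
by move: x; case: k => //= x /ger0_Im h; rewrite [RHS]complexE h mulr0 addr0.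
Qed.

Lemma rnormE (V : normedZmodType K) (x : V) : scalar_emb k (rnorm x) = `|x|.
Proof. by rewrite /rnorm scalar_reK. Qed.

Lemma rnorm_ge0 (V : normedZmodType K) (x : V) : 0 <= rnorm x.
Proof. by rewrite -scalar_emb_le rnormE scalar_emb0. Qed.

Lemma rnormD (V : normedZmodType K) (x y : V) : rnorm (x + y) <= rnorm x + rnorm y.
Proof. by rewrite -scalar_emb_le scalar_embD !rnormE ler_normD. Qed.

Lemma rnorm0 (V : normedZmodType K) : rnorm (0 : V) = 0.
Proof. by apply: scalar_emb_inj; rewrite rnormE normr0 scalar_emb0. Qed.

Lemma rnorm0_eq0 (V : normedZmodType K) (x : V) : rnorm x = 0 -> x = 0.
Proof.
by move=> /(congr1 (@scalar_emb R k)); rewrite rnormE scalar_emb0 => /normr0_eq0.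
Qed.

Lemma rnormN (V : normedZmodType K) (x : V) : rnorm (- x) = rnorm x.
Proof. by rewrite /rnorm normrN. Qed.

Lemma rnormB (V : normedZmodType K) (x y : V) : rnorm (x - y) = rnorm (y - x).
Proof. by rewrite /rnorm distrC. Qed.

Lemma rnormM (x y : K) : rnorm (x * y) = rnorm x * rnorm y.
Proof. by apply: scalar_emb_inj; rewrite scalar_embM !rnormE normrM. Qed.

Lemma rnormZ (V : normedModType K) (a : K) (x : V) :
  rnorm (a *: x) = rnorm a * rnorm x.
Proof. by apply: scalar_emb_inj; rewrite scalar_embM !rnormE normrZ. Qed.

Lemma cvg_rnormP (V : normedModType K) (F : set_system V) (l : V) : Filter F ->
  F --> l <-> (forall e : R, 0 < e -> \forall x \near F, rnorm (l - x) < e).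
Proof.
move=> FF; split=> [/cvgrPdist_lt h e e0|h].
  have := h (scalar_emb k e); rewrite -scalar_emb0 scalar_emb_lt => /(_ e0).
  by apply: filterS => x; rewrite -rnormE scalar_emb_lt.
apply/cvgrPdist_lt => e e0; have := h (scalar_re e).
rewrite -scalar_emb_lt scalar_emb0 scalar_reK ?ltW// => /(_ e0).
by apply: filterS => x; rewrite -scalar_emb_lt rnormE scalar_reK ?ltW.
Qed.

Lemma cauchy_rnormP (V : normedModType K) (F : set_system V) : ProperFilter F ->
  cauchy F <-> (forall e : R, 0 < e -> \forall x & y \near F, rnorm (x - y) < e).
Proof.
move=> FF; split=> [/cauchy_ballP h e e0|h].
  have := h (scalar_emb k e); rewrite -scalar_emb0 scalar_emb_lt => /(_ e0).
  by apply: filterS => -[x y]; rewrite -ball_normE /= -rnormE scalar_emb_lt.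
apply/cauchy_ballP => e e0; have := h (scalar_re e).
rewrite -scalar_emb_lt scalar_emb0 scalar_reK ?ltW// => /(_ e0).
by apply: filterS => -[x y]; rewrite -ball_normE /= -scalar_emb_lt rnormE scalar_reK ?ltW.
Qed.

End ScalarTheory.

Section SequenceSpaces.
Variables (R : realType) (k : scalar_kind).
Local Notation K := (scalar_field R k).

Definition ell1_pred : {pred nat -> K} :=
  fun x => `[< cvgn (series (fun n => rnorm (x n))) >].

Definition c0_pred : {pred nat -> K} := fun x => `[< x @ \oo --> (0 : K) >].

Record ell1 : Type := Ell1 { ell1_val :> nat -> K; _ : ell1_val \in ell1_pred }.
Record c0 : Type := C0 { c0_val :> nat -> K; _ : c0_val \in c0_pred }.

HB.instance Definition _ := [isSub for ell1_val].
HB.instance Definition _ := [Choice of ell1 by <:].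
HB.instance Definition _ := [isSub for c0_val].
HB.instance Definition _ := [Choice of c0 by <:].

Lemma ell1_boundP (x : nat -> K) :
  x \in ell1_pred <-> exists M : R, forall n, series (fun i => rnorm (x i)) n <= M.
Proof.
split=> [/asboolP cx|[M xM]].
  exists (limn (series (fun i => rnorm (x i)))) => n.
  by apply: nondecreasing_cvgn_le => //; apply: nondecreasing_series => i _ _; exact: rnorm_ge0.
apply/asboolP/nondecreasing_is_cvgn.
  by apply: nondecreasing_series => i _ _; exact: rnorm_ge0.
by exists M => _ [n _ <-].
Qed.

Lemma ell1_submod : submod_closed ell1_pred.
Proof.
split.
  by apply/ell1_boundP; exists 0 => n; rewrite /series /= big1// => i _; rewrite rnorm0.
move=> a x y /ell1_boundP[M xM] /ell1_boundP[N yN]; apply/ell1_boundP.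
exists (rnorm a * M + N) => n.
apply: (@le_trans _ _ (rnorm a * series (fun i => rnorm (x i)) n
                       + series (fun i => rnorm (y i)) n)); last first.
  by rewrite lerD// ler_wpM2l ?rnorm_ge0.
rewrite /series /= mulr_sumr -big_split /=; apply: ler_sum => i _.
by rewrite (le_trans (rnormD _ _))// rnormM.
Qed.

HB.instance Definition _ := GRing.isSubmodClosed.Build K (nat -> K) ell1_pred ell1_submod.
HB.instance Definition _ := [SubChoice_isSubLmodule of ell1 by <:].

Lemma c0P (x : nat -> K) : x \in c0_pred <->
  forall e : R, 0 < e -> \forall n \near \oo, rnorm (x n) < e.
Proof.
split=> [/asboolP/cvg_rnormP cx e /cx|cx]; last apply/asboolP/cvg_rnormP => e /cx.
  by rewrite near_map; apply: filterS => n; rewrite sub0r rnormN.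
by rewrite near_map; apply: filterS => n; rewrite sub0r rnormN.
Qed.

Lemma c0_submod : submod_closed c0_pred.
Proof.
split; first by apply/asboolP; exact: cvg_cst.
move=> a x y /asboolP xc /asboolP yc; apply/asboolP.
rewrite -[X in _ --> X]addr0 -[X in _ --> X + _](mulr0 a).
by apply: cvgD => //; apply: cvgM => //; exact: cvg_cst.
Qed.

HB.instance Definition _ := GRing.isSubmodClosed.Build K (nat -> K) c0_pred c0_submod.
HB.instance Definition _ := [SubChoice_isSubLmodule of c0 by <:].

Definition ell1_rnorm (x : ell1) : R := limn (series (fun n => rnorm (x n))).
Definition c0_rnorm (x : c0) : R := sup (range (fun n => rnorm (x n))).

Lemma ell1_rnorm_ub (x : ell1) n : series (fun i => rnorm (x i)) n <= ell1_rnorm x.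
Proof.
apply: nondecreasing_cvgn_le; last by case: x => x /= /asboolP.
by apply: nondecreasing_series => i _ _; exact: rnorm_ge0.
Qed.

Lemma ell1_rnorm_le (x : ell1) M :
  (forall n, series (fun i => rnorm (x i)) n <= M) -> ell1_rnorm x <= M.
Proof.
move=> xM; apply: limr_le; first by case: x {xM} => x /= /asboolP.
exact: nearW.
Qed.

Lemma ell1_coord_le (x : ell1) n : rnorm (x n) <= ell1_rnorm x.
Proof.
apply: le_trans (ell1_rnorm_ub x n.+1).
by rewrite /series /= big_nat_recr //= lerDr; apply: sumr_ge0 => i _; exact: rnorm_ge0.
Qed.

Lemma c0_has_sup (x : c0) : has_sup (range (fun n => rnorm (x n))).
Proof.
split; first by exists (rnorm (x 0%N)), 0%N.
case: x => x /= /c0P /(_ 1 ltr01) [N _ xN].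
exists (1 + \sum_(i < N) rnorm (x i)) => _ [n _ <-].
have s0 m (P : pred 'I_m) : 0 <= \sum_(i < m | P i) rnorm (x i).
  by apply: sumr_ge0 => i _; exact: rnorm_ge0.
have [Nn|nN] := leqP N n; first by rewrite (le_trans (ltW (xN _ Nn)))// lerDl.
by rewrite (bigD1 (Ordinal nN)) //= addrCA lerDl; apply: addr_ge0 => //; exact: s0.
Qed.

Lemma c0_coord_le (x : c0) n : rnorm (x n) <= c0_rnorm x.
Proof. by apply: ub_le_sup; [exact: (c0_has_sup x).2|exists n]. Qed.

Lemma c0_rnorm_le (x : c0) M : (forall n, rnorm (x n) <= M) -> c0_rnorm x <= M.
Proof.
move=> xM; apply: ge_sup; first exact: (c0_has_sup x).1.
by move=> _ [n _ <-].
Qed.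

Definition ell1_norm (x : ell1) : K := scalar_emb k (ell1_rnorm x).
Definition c0_norm (x : c0) : K := scalar_emb k (c0_rnorm x).

Lemma ell1_normD (x y : ell1) : ell1_norm (x + y) <= ell1_norm x + ell1_norm y.
Proof.
rewrite -scalar_embD scalar_emb_le; apply: ell1_rnorm_le => n.
apply: le_trans (lerD (ell1_rnorm_ub x n) (ell1_rnorm_ub y n)).
by rewrite /series /= -big_split /=; apply: ler_sum => i _; exact: rnormD.
Qed.

Lemma ell1_normZ (a : K) (x : ell1) : ell1_norm (a *: x) = `|a| * ell1_norm x.
Proof.
rewrite -rnormE -scalar_embM; congr scalar_emb.
rewrite /ell1_rnorm -[RHS]/(rnorm a *: _) -lim_seriesZ; last by case: x => x /= /asboolP.
by congr (limn (series _)); apply/funext => n; rewrite /= rnormM.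
Qed.

Lemma ell1_norm0_eq0 (x : ell1) : ell1_norm x = 0 -> x = 0.
Proof.
rewrite -(scalar_emb0 _ k) => /scalar_emb_inj x0; apply/val_inj/funext => n.
by apply/rnorm0_eq0/le_anti; rewrite rnorm_ge0 -x0 ell1_coord_le.
Qed.

HB.instance Definition _ := Lmodule_isNormed.Build K ell1 ell1_normD ell1_normZ ell1_norm0_eq0.

Lemma c0_normD (x y : c0) : c0_norm (x + y) <= c0_norm x + c0_norm y.
Proof.
rewrite -scalar_embD scalar_emb_le; apply: c0_rnorm_le => n.
by rewrite (le_trans (rnormD _ _))// lerD// c0_coord_le.
Qed.

Lemma c0_normZ (a : K) (x : c0) : c0_norm (a *: x) = `|a| * c0_norm x.
Proof.
rewrite -rnormE -scalar_embM; congr scalar_emb; apply/le_anti/andP; split.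
  by apply: c0_rnorm_le => n; rewrite rnormM ler_wpM2l ?rnorm_ge0 ?c0_coord_le.
have [->|a0] := eqVneq (rnorm a) 0.
  by rewrite mul0r (le_trans _ (c0_coord_le _ 0%N))// rnorm_ge0.
have {}a0 : 0 < rnorm a by rewrite lt_neqAle eq_sym a0 rnorm_ge0.
rewrite -ler_pdivlMl//; apply: c0_rnorm_le => n.
by rewrite ler_pdivlMl// -rnormM; exact: (c0_coord_le (a *: x)).
Qed.

Lemma c0_norm0_eq0 (x : c0) : c0_norm x = 0 -> x = 0.
Proof.
rewrite -(scalar_emb0 _ k) => /scalar_emb_inj x0; apply/val_inj/funext => n.
by apply/rnorm0_eq0/le_anti; rewrite rnorm_ge0 -x0 c0_coord_le.
Qed.

HB.instance Definition _ := Lmodule_isNormed.Build K c0 c0_normD c0_normZ c0_norm0_eq0.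

Lemma rnorm_ell1E (x : ell1) : rnorm x = ell1_rnorm x.
Proof. exact: scalar_embK. Qed.

Lemma rnorm_c0E (x : c0) : rnorm x = c0_rnorm x.
Proof. exact: scalar_embK. Qed.

End SequenceSpaces.

Lemma real_rcauchy_cvg (R : realType) (T : Type) (F : set_system T) (f : T -> R) :
  ProperFilter F ->
  (forall e : R, 0 < e -> \forall x & y \near F, `|f x - f y| < e) ->
  exists l : R, forall e : R, 0 < e -> \forall x \near F, `|l - f x| < e.
Proof.
move=> FF Fc; have /R_complete /cvg_ex[l /cvgrPdist_lt fl] : cauchy (f @ F).
  apply/cauchy_ballP => e e0; have [[A B] /= [FA FB] AB] := Fc e e0.
  exists (f @` A, f @` B) => /=.
    by split; [apply: filterS FA|apply: filterS FB] => x Ax; exists x.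
  by move=> [_ _] /= [[x Ax <-] [y By <-]]; rewrite -ball_normE; apply: (AB (x, y)).
by exists l.
Qed.

Lemma scalar_rcauchy_cvg (R : realType) (k : scalar_kind) (T : Type)
    (F : set_system T) (f : T -> scalar_field R k) : ProperFilter F ->
  (forall e : R, 0 < e -> \forall x & y \near F, rnorm (f x - f y) < e) ->
  exists l, forall e : R, 0 < e -> \forall x \near F, rnorm (l - f x) < e.
Proof.
case: k f => f FF Fc; first exact: real_rcauchy_cvg Fc.
have leRe (z : scalar_field R ComplexScalars) : `|complex.Re z| <= rnorm z.
  by case: z => a b; rewrite /rnorm /= -sqrtr_sqr ler_wsqrtr// lerDl sqr_ge0.
have leIm (z : scalar_field R ComplexScalars) : `|complex.Im z| <= rnorm z.
  by case: z => a b; rewrite /rnorm /= -sqrtr_sqr ler_wsqrtr// lerDr sqr_ge0.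
have geRI (z : scalar_field R ComplexScalars) :
    rnorm z <= `|complex.Re z| + `|complex.Im z|.
  case: z => a b; rewrite /rnorm /= -[leRHS]ger0_norm ?addr_ge0// -sqrtr_sqr.
  rewrite ler_wsqrtr// sqrrD !real_normK ?num_real// -addrA lerD2l lerDr.
  by rewrite mulrn_wge0 ?mulr_ge0.
have [] := @real_rcauchy_cvg R T F (fun x => complex.Re (f x)) FF.
  move=> e e0; apply: filterS (Fc e e0) => -[x y] /=; apply: le_lt_trans.
  by apply: le_trans (leRe _); case: (f x) (f y) => a b [c d].
move=> a fa; have [] := @real_rcauchy_cvg R T F (fun x => complex.Im (f x)) FF.
  move=> e e0; apply: filterS (Fc e e0) => -[x y] /=; apply: le_lt_trans.
  by apply: le_trans (leIm _); case: (f x) (f y) => ? b [c d].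
move=> b fb; exists (Complex a b : scalar_field R ComplexScalars) => e e0.
have e2 : 0 < e / 2 by rewrite divr_gt0.
near=> x; rewrite (le_lt_trans (geRI _))// [ltRHS]splitr ltrD//.
  by have : `|a - complex.Re (f x)| < e / 2 by [near: x; exact: fa]; case: (f x).
by have : `|b - complex.Im (f x)| < e / 2 by [near: x; exact: fb]; case: (f x).
Unshelve. all: by end_near. Qed.

Section Completeness.
Variables (R : realType) (k : scalar_kind).
Local Notation K := (scalar_field R k).

Lemma coord_complete (V : normedModType K) (c : V -> nat -> K) :
  (forall x y n, c (x - y) n = c x n - c y n) ->
  (forall x n, rnorm (c x n) <= rnorm x) ->
  (forall (F : set_system V) (l : nat -> K), ProperFilter F ->
     (forall n (d : R), 0 < d -> \forall x \near F, rnorm (l n - c x n) < d) ->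
     (forall e : R, 0 < e ->
        \forall a \near F, \forall x \near F, rnorm (a - x) <= e) ->
     exists x : V, c x = l) ->
  (forall (F : set_system V) (a x : V) (e : R), ProperFilter F ->
     (forall n d, 0 < d -> \forall y \near F, rnorm (c x n - c y n) < d) ->
     (\forall y \near F, rnorm (a - y) <= e) -> rnorm (a - x) <= e) ->
  forall F : set_system V, ProperFilter F -> cauchy F -> cvg F.
Proof.
move=> cB cle clim ccl F FF /cauchy_rnormP Fc.
have cF n : exists l, forall d : R, 0 < d -> \forall x \near F, rnorm (l - c x n) < d.
  apply: scalar_rcauchy_cvg => e /Fc; apply: filterS => -[x y] /=.
  by apply: le_lt_trans; rewrite -cB.
have [l cl] := choice cF.
have Fe (e : R) : 0 < e -> \forall a \near F, \forall x \near F, rnorm (a - x) <= e.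
  move=> /Fc[[A B] /= [FA FB] AB]; apply: filterS FA => a Aa.
  by apply: filterS FB => b Bb; apply/ltW/(AB (a, b)).
have [x xl] := clim F l FF cl Fe.
apply/cvg_ex; exists x; apply/cvg_rnormP => e e0.
have e2 : 0 < e / 2 by rewrite divr_gt0.
apply: filterS (Fe _ e2) => a ax; rewrite rnormB.
apply: (@le_lt_trans _ _ (e / 2)); last by rewrite ltr_pdivrMr ?ltr_pMr ?ltr1n.
by apply: (ccl F) => //; rewrite xl.
Qed.

Lemma ell1_complete (F : set_system (ell1 R k)) : ProperFilter F -> cauchy F -> cvg F.
Proof.
have le_e (G : set_system (ell1 R k)) (a : ell1 R k) (l : nat -> K) (e : R) :
    ProperFilter G ->
    (forall n d, 0 < d -> \forall x \near G, rnorm (l n - ell1_val x n) < d) ->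
    (\forall x \near G, rnorm (a - x) <= e) ->
    forall n, series (fun i => rnorm (a i - l i)) n <= e.
  move=> GG cl ae n; apply/ler_addgt0Pr => d d0.
  have n0 : 0 < d / n.+1%:R by rewrite divr_gt0.
  have : \forall x \near G, forall i : 'I_n, rnorm (l i - ell1_val x i) < d / n.+1%:R.
    by apply: filter_forall => i; exact: cl.
  move=> /(filterI ae)/filter_ex[x [/= ax lx]].
  apply: le_trans (lerD ax (_ : \sum_(i < n) rnorm (x i - l i) <= d)).
    rewrite rnorm_ell1E; apply: le_trans (lerD (ell1_rnorm_ub _ n) (lexx _)).
    rewrite /series /= !big_mkord -big_split /=; apply: ler_sum => i _.
    by rewrite (le_trans _ (rnormD _ _))// addrA subrK.
  apply: le_trans (_ : \sum_(i < n) (d / n.+1%:R) <= d).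
    by apply: ler_sum => i _; rewrite rnormB ltW.
  rewrite sumr_const card_ord -[leLHS]mulr_natr mulrAC ler_pdivrMr//.
  by rewrite ler_wpM2l ?ltW// ltr_nat.
apply: (@coord_complete _ (@ell1_val R k)) => //.
- by move=> x n; rewrite rnorm_ell1E ell1_coord_le.
- move=> G l GG cl /(_ 1 ltr01)/filter_ex[a /le_e a1].
  have al : (fun i => a i - l i) \in @ell1_pred R k.
    by apply/ell1_boundP; exists 1; exact: a1.
  by exists (a - Ell1 al); apply/funext => i /=; rewrite opprB addrC subrK.
- move=> G a x e GG cx ae; rewrite rnorm_ell1E; apply: ell1_rnorm_le.
  exact: le_e ae.
Qed.

HB.instance Definition _ := Uniform_isComplete.Build (ell1 R k) ell1_complete.

Lemma c0_complete (F : set_system (c0 R k)) : ProperFilter F -> cauchy F -> cvg F.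
Proof.
have le_e (G : set_system (c0 R k)) (a : c0 R k) (l : nat -> K) (e : R) :
    ProperFilter G ->
    (forall n d, 0 < d -> \forall x \near G, rnorm (l n - c0_val x n) < d) ->
    (\forall x \near G, rnorm (a - x) <= e) ->
    forall n, rnorm (a n - l n) <= e.
  move=> GG cl ae n; apply/ler_addgt0Pr => d d0.
  have /(filterI ae)/filter_ex[x [/= ax lx]] := cl n _ d0.
  apply: le_trans (lerD ax (ltW lx)); rewrite rnorm_c0E [rnorm (l n - _)]rnormB.
  apply: le_trans (lerD (c0_coord_le _ n) (lexx _)).
  by rewrite (le_trans _ (rnormD _ _))// addrA subrK.
apply: (@coord_complete _ (@c0_val R k)) => //.
- by move=> x n; rewrite rnorm_c0E c0_coord_le.
- move=> G l GG cl Ge; suff lc : l \in @c0_pred R k by exists (C0 lc).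
  apply/c0P => e e0; have e2 : 0 < e / 2 by rewrite divr_gt0.
  have /filter_ex[a /(le_e _ _ _ _ _ cl) al] := Ge _ e2.
  have /c0P /(_ _ e2) : c0_val a \in @c0_pred R k by case: (a).
  apply: filterS => n an; rewrite -[l n](subrK (a n)) [ltRHS]splitr.
  by rewrite (le_lt_trans (rnormD _ _))// ler_ltD// rnormB.
- move=> G a x e GG cx ae; rewrite rnorm_c0E; apply: c0_rnorm_le.
  exact: le_e ae.
Qed.

HB.instance Definition _ := Uniform_isComplete.Build (c0 R k) c0_complete.

End Completeness.

Section NormAttainment.
Variables (R : realType) (k : scalar_kind).

Definition opnorm (X Y : normedModType (scalar_field R k)) (T : X -> Y) : R :=
  sup [set rnorm (T x) | x in [set x : X | rnorm x <= 1]].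

Definition bounded_operator (X Y : normedModType (scalar_field R k))
    (T : {linear X -> Y}) : Prop :=
  bounded_near T (nbhs (0 : X)).

Definition property_Lpo (X Y : completeNormedModType (scalar_field R k)) : Prop :=
  forall (e : R) (T : {linear X -> Y}),
    0 < e -> bounded_operator T -> opnorm T = 1 ->
  exists2 eta : R, 0 < eta &
    forall x : X, rnorm x = 1 -> 1 - eta < rnorm (T x) ->
    exists S : {linear X -> Y},
      [/\ bounded_operator S, opnorm S = 1, rnorm (S x) = 1
        & opnorm (S \- T) < e].

Definition property_Lop (X Y : completeNormedModType (scalar_field R k)) : Prop :=
  forall (e : R) (x : X), 0 < e -> rnorm x = 1 ->
  exists2 eta : R, 0 < eta &
    forall T : {linear X -> Y}, bounded_operator T -> opnorm T = 1 ->
      1 - eta < rnorm (T x) ->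
    exists x0 : X, [/\ rnorm x0 = 1, rnorm (T x0) = 1 & rnorm (x0 - x) < e].

End NormAttainment.

(* Main.v *)
Require Import Defs.
From HB Require Import structures.
From mathcomp Require Import all_boot all_order all_algebra.
From mathcomp Require Import all_classical all_reals all_analysis.
From mathcomp Require Import lra.

(** Both failures come from one two-dimensional configuration: unit vectors
    [u], [v] and functionals [phi], [psi] of norm one such that

      phi u = 1,  phi v = 1,  psi u = 0,  psi v = 1.

    So [phi] exposes a face of the ball containing the segment [u, v], and [v]
    lies on the two faces exposed by [phi] and [psi].  Fix a unit vector [y] of
    the target space.

    L_{o,p} fails at the point [u].  The operators
    [T_t = ((1 - t) phi + t psi) y] have norm one, attained at [v], and
    [T_t u = (1 - t) y] has norm close to one for small [t > 0].  A unit vector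
    [z] at which [T_t] attains its norm must satisfy [|psi z| = 1], and since
    [psi u = 0] it stays at distance at least one from [u]
    (lemma [not_Lop_of_faces]).

    L_{p,o} fails at the operator [T_1 = psi y].  The points
    [x_d = (1 - d) v + d u] lie in the face exposed by [phi], hence have norm
    one, and [T_1 x_d] has norm [1 - d].  If [S] has norm one and attains it at
    the proper convex combination [x_d], then it attains it at [u] too; as
    [T_1 u = 0], the distance from [S] to [T_1] is at least one
    (lemma [not_Lpo_of_faces]).

    Such a configuration exists in both spaces: in [ell_1] take [u = e_0],
    [v = e_1], [phi x = x_0 + x_1], [psi x = x_1]; in [c_0] take [u = e_0],
    [v = e_0 + e_1], [phi x = x_0], [psi x = x_1]. *)

Set Implicit Arguments.
Unset Strict Implicit.
Unset Printing Implicit Defensive.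

Import Order.TTheory GRing.Theory Num.Theory.

Local Open Scope classical_set_scope.
Local Open Scope ring_scope.

(** * Scalars and operator norms *)

Lemma scalar_emb1 (R : realType) (k : scalar_kind) : scalar_emb k (1 : R) = 1.
Proof. by case: k. Qed.

Lemma rnorm_emb (R : realType) (k : scalar_kind) (r : R) :
  0 <= r -> rnorm (scalar_emb k r) = r.
Proof.
move=> r0; apply: (@scalar_emb_inj R k); rewrite rnormE ger0_norm//.
by rewrite -(scalar_emb0 R k) scalar_emb_le.
Qed.

Lemma rnorm1 (R : realType) (k : scalar_kind) : rnorm (1 : scalar_field R k) = 1.
Proof. by rewrite -scalar_emb1 rnorm_emb. Qed.

Lemma unit_vector (R : realType) (k : scalar_kind)
    (Y : normedModType (scalar_field R k)) :
  (exists y : Y, y != 0) -> exists y : Y, rnorm y = 1.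
Proof.
move=> [y y0]; have ny : 0 < rnorm y.
  rewrite lt_neqAle rnorm_ge0 andbT eq_sym.
  by apply: contra_neq y0; exact: rnorm0_eq0.
exists (scalar_emb k (rnorm y)^-1 *: y).
by rewrite rnormZ rnorm_emb ?invr_ge0 ?rnorm_ge0// mulVf// gt_eqF.
Qed.

(** The library bounds linear maps by constants of the scalar field; here the
    constant is a real number in both scalar cases, so that real order
    reasoning applies to operator norms. *)
Lemma bounded_operatorP (R : realType) (k : scalar_kind)
    (X Y : normedModType (scalar_field R k)) (T : {linear X -> Y}) :
  bounded_operator T <->
  exists M : R, forall x, rnorm (T x) <= M * rnorm x.
Proof.
split=> [/linear_boundedP/(pinfty_ex_ge (real0 _))[M M0 TM]|[M TM]].
  exists (scalar_re M) => x.
  by rewrite -(scalar_emb_le k) scalar_embM scalar_reK// !rnormE.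
apply/linear_boundedP.
have M'r : scalar_emb k `|M| \is Num.real.
  by rewrite ger0_real// -(scalar_emb0 R k) scalar_emb_le.
apply: filterS (nbhs_pinfty_ge M'r) => r Mr x.
apply: le_trans (ler_wpM2r (normr_ge0 x) Mr).
rewrite -!rnormE -scalar_embM scalar_emb_le (le_trans (TM x))//.
by rewrite ler_wpM2r ?rnorm_ge0 ?ler_norm.
Qed.

Lemma opnorm_le (R : realType) (k : scalar_kind)
    (X Y : normedModType (scalar_field R k)) (T : X -> Y) (c : R) :
  (forall x, rnorm x <= 1 -> rnorm (T x) <= c) -> opnorm T <= c.
Proof.
move=> Tc; apply: ge_sup; last by move=> _ [x /= x1 <-]; exact: Tc.
by exists (rnorm (T 0)), 0 => //=; rewrite rnorm0.
Qed.

Lemma opnorm_ub (R : realType) (k : scalar_kind)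
    (X Y : normedModType (scalar_field R k)) (T : {linear X -> Y}) (x : X) :
  bounded_operator T -> rnorm x <= 1 -> rnorm (T x) <= opnorm T.
Proof.
move=> /bounded_operatorP[M TM] x1; apply: ub_le_sup; last by exists x.
exists `|M| => _ [z /= z1 <-]; apply: le_trans (TM z) _.
apply: le_trans (_ : `|M| * rnorm z <= _).
  by rewrite ler_wpM2r ?rnorm_ge0 ?ler_norm.
by rewrite ler_piMr.
Qed.

Lemma bounded_operatorB (R : realType) (k : scalar_kind)
    (X Y : normedModType (scalar_field R k)) (S T : {linear X -> Y}) :
  bounded_operator S -> bounded_operator T -> bounded_operator (S \- T).
Proof.
move=> /bounded_operatorP[M SM] /bounded_operatorP[N TN].
apply/bounded_operatorP; exists (M + N) => x.
by rewrite mulrDl (le_trans (rnormD _ _))// rnormN lerD.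
Qed.

(** * The pencil of rank-one operators *)

(** The same formula serves both properties: small [t > 0] gives the operators
    [T_t] that defeat L_{o,p}, and [t = 1] gives the operator [psi y] that
    defeats L_{p,o}. *)
Definition pencil (R : realType) (k : scalar_kind)
    (X Y : normedModType (scalar_field R k)) (phi psi : X -> scalar_field R k)
    (y : Y) (t : R) (x : X) : Y :=
  (scalar_emb k (1 - t) * phi x + scalar_emb k t * psi x) *: y.

Lemma pencil_linear (R : realType) (k : scalar_kind)
    (X Y : normedModType (scalar_field R k)) (phi psi : X -> scalar_field R k)
    (y : Y) (t : R) :
  scalar phi -> scalar psi -> linear (pencil phi psi y t).
Proof.
move=> lphi lpsi a x z; rewrite /pencil lphi lpsi scalerA -scalerDl.
congr (_ *: _); rewrite !mulrDr addrACA; congr (_ + _ + _).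
  by rewrite !mulrA [_ * a]mulrC.
by rewrite !mulrA [_ * a]mulrC.
Qed.

Lemma rnorm_pencil_le (R : realType) (k : scalar_kind)
    (X Y : normedModType (scalar_field R k)) (phi psi : X -> scalar_field R k)
    (y : Y) (t : R) (x : X) : rnorm y = 1 -> 0 <= t <= 1 ->
  rnorm (pencil phi psi y t x) <= (1 - t) * rnorm (phi x) + t * rnorm (psi x).
Proof.
move=> y1 /andP[t0 t1]; rewrite rnormZ y1 mulr1 (le_trans (rnormD _ _))//.
by rewrite !rnormM !rnorm_emb// subr_ge0.
Qed.

(** Every functional of the segment from [phi] to [psi] has norm at most one and
    takes the value one at [v], so that the whole pencil has norm one. *)
Lemma pencil_operator (R : realType) (k : scalar_kind)
    (X Y : normedModType (scalar_field R k)) (phi psi : X -> scalar_field R k)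
    (v : X) (y : Y) (t : R) :
  scalar phi -> scalar psi ->
  (forall x, rnorm (phi x) <= rnorm x) -> (forall x, rnorm (psi x) <= rnorm x) ->
  rnorm v <= 1 -> phi v = 1 -> psi v = 1 -> rnorm y = 1 -> 0 <= t <= 1 ->
  exists T : {linear X -> Y},
    [/\ T =1 pencil phi psi y t, bounded_operator T & opnorm T = 1].
Proof.
move=> lphi lpsi phi_le psi_le v1 phiv psiv y1 t01.
pose L := GRing.isLinear.Build _ _ _ _ _ (pencil_linear y t lphi lpsi).
pose T : {linear X -> Y} := HB.pack (pencil phi psi y t) L.
have T_le x : rnorm (T x) <= rnorm x.
  apply: le_trans (rnorm_pencil_le phi psi x y1 t01) _.
  have /andP[t0 t1] := t01; have := phi_le x; have := psi_le x; nra.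
have Tb : bounded_operator T.
  by apply/bounded_operatorP; exists 1 => x; rewrite mul1r.
exists T; split => //; apply/le_anti/andP; split.
  by apply: opnorm_le => x; apply: le_trans.
apply: le_trans (opnorm_ub Tb v1).
rewrite /T /= /pencil phiv psiv !mulr1 -scalar_embD subrK scalar_emb1 scale1r.
by rewrite y1.
Qed.

(** * Failure of both properties from two faces *)

(** [|T_t z| <= 1 - t + t |psi z|] on the unit sphere, so an operator of the
    pencil with [t > 0] attains its norm only where [|psi| = 1], far from the
    kernel of [psi]. *)
Lemma not_Lop_of_faces (R : realType) (k : scalar_kind)
    (X Y : completeNormedModType (scalar_field R k))
    (phi psi : X -> scalar_field R k) (u v : X) :
  (exists y : Y, y != 0) -> scalar phi -> scalar psi ->
  (forall x, rnorm (phi x) <= rnorm x) -> (forall x, rnorm (psi x) <= rnorm x) ->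
  rnorm u <= 1 -> rnorm v <= 1 ->
  phi u = 1 -> phi v = 1 -> psi u = 0 -> psi v = 1 ->
  ~ property_Lop X Y.
Proof.
move=> /unit_vector[y y1] lphi lpsi phi_le psi_le u1 v1 phiu phiv psiu psiv Lop.
have nu : rnorm u = 1.
  by apply/le_anti; rewrite u1 -(rnorm1 R k) -phiu phi_le.
have [eta eta0 Heta] := Lop 1 u ltr01 nu.
have [t [t0 t1 teta]] : exists t, [/\ 0 < t, t <= 1 & t < eta].
  by exists (Num.min eta 1 / 2); case: (leP eta 1) => ?; split; lra.
have t01 : 0 <= t <= 1 by rewrite ltW.
have [T [TE Tb T1]] :=
  pencil_operator lphi lpsi phi_le psi_le v1 phiv psiv y1 t01.
have Tu : rnorm (T u) = 1 - t.
  by rewrite TE /pencil phiu psiu mulr1 mulr0 addr0 rnormZ y1 mulr1 rnorm_emb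
    ?subr_ge0.
have [|z [nz Tz zu]] := Heta T Tb T1; first by rewrite Tu; lra.
have psizu : psi (z - u) = psi z.
  by have := lpsi (-1) u z; rewrite psiu mulr0 add0r scaleN1r addrC.
have := rnorm_pencil_le phi psi z y1 t01; rewrite -TE Tz.
have phiz : (1 - t) * rnorm (phi z) <= 1 - t.
  by rewrite ler_piMr ?subr_ge0// -nz phi_le.
have psiz : t * rnorm (psi z) < t.
  by rewrite gtr_pMr// -psizu (le_lt_trans (psi_le _) zu).
lra.
Qed.

(** An operator of norm one which attains its norm at a proper convex
    combination of [v] and [u] attains it at [u], where [psi] vanishes; such
    combinations may be taken arbitrarily close to [v], where [psi] is one. *)
Lemma not_Lpo_of_faces (R : realType) (k : scalar_kind)
    (X Y : completeNormedModType (scalar_field R k))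
    (phi psi : X -> scalar_field R k) (u v : X) :
  (exists y : Y, y != 0) -> scalar phi -> scalar psi ->
  (forall x, rnorm (phi x) <= rnorm x) -> (forall x, rnorm (psi x) <= rnorm x) ->
  rnorm u <= 1 -> rnorm v <= 1 ->
  phi u = 1 -> phi v = 1 -> psi u = 0 -> psi v = 1 ->
  ~ property_Lpo X Y.
Proof.
move=> /unit_vector[y y1] lphi lpsi phi_le psi_le u1 v1 phiu phiv psiu psiv Lpo.
have t01 : 0 <= (1 : R) <= 1 by rewrite ler01 lexx.
have [T [TE Tb T1]] :=
  pencil_operator lphi lpsi phi_le psi_le v1 phiv psiv y1 t01.
have {}TE x : T x = psi x *: y.
  by rewrite TE /pencil subrr scalar_emb0 scalar_emb1 mul0r mul1r add0r.
have [eta eta0 Heta] := Lpo 1 T ltr01 Tb T1.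
have [d [d0 d1 deta]] : exists d, [/\ 0 < d, d < 1 & d < eta].
  by exists (Num.min eta 1 / 2); case: (leP eta 1) => ?; split; lra.
have d0' : 0 <= 1 - d by lra.
pose x := scalar_emb k (1 - d) *: v + scalar_emb k d *: u.
have lin0 (f : X -> scalar_field R k) : scalar f ->
    f x = scalar_emb k (1 - d) * f v + scalar_emb k d * f u.
  move=> lf; have f0 : f 0 = 0.
    by have := lf (-1) 0 0; rewrite scaler0 addr0 mulN1r addNr.
  by rewrite lf -[scalar_emb k d *: u]addr0 lf f0 addr0.
have phix : phi x = 1.
  by rewrite lin0// phiu phiv !mulr1 -scalar_embD subrK scalar_emb1.
have psix : psi x = scalar_emb k (1 - d).
  by rewrite lin0// psiu psiv mulr1 mulr0 addr0.
have nx : rnorm x = 1.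
  apply/le_anti/andP; split; last by rewrite -(rnorm1 R k) -phix phi_le.
  rewrite (le_trans (rnormD _ _))// !rnormZ !rnorm_emb ?(ltW d0)//.
  rewrite -[leRHS](subrK d) lerD ?ler_piMr ?(ltW d0)//.
have [|S [Sb S1 Sx ST]] := Heta x nx.
  by rewrite TE psix rnormZ y1 mulr1 rnorm_emb//; lra.
have Sv : rnorm (S v) <= 1 by rewrite -S1 opnorm_ub.
have Su : 1 <= rnorm (S u).
  have Sxd : 1 <= (1 - d) * rnorm (S v) + d * rnorm (S u).
    rewrite -[leLHS]Sx /x linearD !linearZ/= (le_trans (rnormD _ _))//.
    by rewrite !rnormZ !rnorm_emb// ltW.
  have Svd : (1 - d) * rnorm (S v) <= 1 - d by rewrite ler_piMr.
  by rewrite -(ler_pMr _ d0); lra.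
have := opnorm_ub (bounded_operatorB Sb Tb) u1.
rewrite /= TE psiu scale0r subr0 => STu.
by have := le_lt_trans (le_trans Su STu) ST; rewrite ltxx.
Qed.

(** * The configuration in the two sequence spaces *)

Lemma rnorm_unit_coord (R : realType) (k : scalar_kind) (n i : nat) :
  rnorm ((i == n)%:R : scalar_field R k) = (i == n)%:R.
Proof. by case: (i == n); rewrite ?rnorm1 ?rnorm0. Qed.

Lemma series_unit_le1 (R : realType) (k : scalar_kind) (n m : nat) :
  series (fun i => rnorm ((i == n)%:R : scalar_field R k)) m <= 1.
Proof.
rewrite /series /=; under eq_bigr do rewrite rnorm_unit_coord.
rewrite big_mkord; case: (ltnP n m) => [nm|mn].
  rewrite (bigD1 (Ordinal nm)) //= eqxx big1 ?addr0// => i.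
  by rewrite -val_eqE /= => /negbTE ->.
by rewrite big1// => i _; rewrite ltn_eqF// (leq_trans (ltn_ord i)).
Qed.

Lemma ell1_unit (R : realType) (k : scalar_kind) (n : nat) :
  exists2 e : ell1 R k, rnorm e <= 1 & forall i, e i = (i == n)%:R.
Proof.
have en : (fun i => (i == n)%:R) \in @ell1_pred R k.
  by apply/ell1_boundP; exists 1; exact: series_unit_le1.
exists (Ell1 en) => //.
by rewrite rnorm_ell1E; apply: ell1_rnorm_le; exact: series_unit_le1.
Qed.

Lemma c0_prefix (R : realType) (k : scalar_kind) (n : nat) :
  exists2 e : c0 R k, rnorm e <= 1 & forall i, e i = (i < n)%N%:R.
Proof.
have en : (fun i => (i < n)%N%:R) \in @c0_pred R k.
  apply/c0P => e e0; exists n => // i /= ni.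
  by rewrite ltnNge ni rnorm0.
exists (C0 en) => //; rewrite rnorm_c0E; apply: c0_rnorm_le => i /=.
by case: (i < n)%N; rewrite ?rnorm1 ?rnorm0.
Qed.

Theorem corollary2p12 (R : realType) (k : scalar_kind)
    (Y : completeNormedModType (scalar_field R k)) (Y_neq0 : exists y : Y, y != 0) :
  (~ property_Lop (ell1 R k) Y /\ ~ property_Lpo (ell1 R k) Y) /\
  (~ property_Lop (c0 R k) Y /\ ~ property_Lpo (c0 R k) Y).
Proof.
split.
- have [u u1 uE] := ell1_unit R k 0; have [v v1 vE] := ell1_unit R k 1.
  pose phi (x : ell1 R k) := x 0%N + x 1%N; pose psi (x : ell1 R k) := x 1%N.
  have lphi : scalar phi by move=> a x z; rewrite /phi /= mulrDr addrACA.
  have lpsi : scalar psi by [].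
  have phi_le x : rnorm (phi x) <= rnorm x.
    rewrite (le_trans (rnormD _ _))// rnorm_ell1E.
    apply: le_trans (ell1_rnorm_ub x 2).
    by rewrite /series /= !big_nat_recr//= big_nil add0r.
  have psi_le x : rnorm (psi x) <= rnorm x.
    by rewrite rnorm_ell1E; exact: ell1_coord_le.
  have phiu : phi u = 1 by rewrite /phi !uE addr0.
  have phiv : phi v = 1 by rewrite /phi !vE add0r.
  split; [apply: (@not_Lop_of_faces _ _ _ _ phi psi u v)
         |apply: (@not_Lpo_of_faces _ _ _ _ phi psi u v)] => //.
  + by rewrite /psi uE.
  + by rewrite /psi vE.
  + by rewrite /psi uE.
  + by rewrite /psi vE.
- have [u u1 uE] := c0_prefix R k 1; have [v v1 vE] := c0_prefix R k 2.
  have coord_le i (x : c0 R k) : rnorm (x i) <= rnorm x.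
    by rewrite rnorm_c0E; exact: c0_coord_le.
  by split; [apply: (@not_Lop_of_faces _ _ _ _ (@c0_val R k ^~ 0%N)
                       (@c0_val R k ^~ 1%N) u v)
            |apply: (@not_Lpo_of_faces _ _ _ _ (@c0_val R k ^~ 0%N)
                       (@c0_val R k ^~ 1%N) u v)] => //; rewrite ?uE ?vE.
Qed.
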